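(* Let $G=\{x_0,x_1,\dots,x_{n-1}\}$ be a finite abelian group of order $n$ with Cayley table $M_G$, let $\hat G$ be its dual group, and let $\gamma\in G$ and $\pi\in \mathfrak S_n$. Then: (1) $\gamma\cdot\boldsymbol{x}(\pi)=\boldsymbol{x}(\pi\sigma_\gamma^{-1})$, where $\cdot$ is the natural $G$-action on $S^nR$; (2) $\boldsymbol{x}(\pi)=\boldsymbol{x}(\pi^{-1})$; (3) $\mathrm{per}(M_G)\in(S^nR)^G$; (4) if $\hat G$ has a unique element of order $2$, say $\psi$, then $\det(M_G)$ is a semi-invariant of weight $\psi$; in all other cases, $\det(M_G)\in(S^nR)^G$.
   Context: The group operation of $G$ is denoted $\dotplus$. The elements $x_0,\dots,x_{n-1}$ of $G$ are also regarded as independent variables of $\mathbb C[x_0,\dots,x_{n-1}]$, identified with the symmetric algebra $S^{\cdot}R$ of the regular representation $R$ of $G$ over $\mathbb C$ (with basis $x_0,\dots,x_{n-1}$); $S^nR$ is the space of homogeneous polynomials of degree $n$. The group $G$ acts on $\mathbb C[x_0,\dots,x_{n-1}]$ by algebra automorphisms with $\gamma\cdot x_i=\gamma\dotplus x_i$ (the variable corresponding to this group element), and $(S^nR)^G$ is the subspace of invariants. A polynomial $f$ is a semi-invariant of weight $\chi\in\hat G=\mathrm{Hom}(G,\mathbb C^\times)$ if $\gamma\cdot f=\chi(\gamma)f$ for all $\gamma\in G$. $\mathfrak S_n$ is the group of permutations of $\{0,\dots,n-1\}$. The Cayley table is the $n\times n$ matrix $M_G=(m_{i,j})_{0\le i,j\le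 n-1}$, where $m_{i,j}=x_i\dotplus x_j$ is the variable corresponding to that group element; $\mathrm{per}$ is the permanent, $\mathrm{per}(M_G)=\sum_{\pi\in\mathfrak S_n}\prod_{i}m_{i,\pi(i)}$. For $\pi\in\mathfrak S_n$, $\boldsymbol{x}(\pi)=\prod_{i=0}^{n-1}(x_i\dotplus x_{\pi(i)})$, a monomial of degree $n$ (the product of the variables $m_{i,\pi(i)}$). For $\gamma\in G$, $\sigma_\gamma\in\mathfrak S_n$ is the permutation defined by $x_{\sigma_\gamma(i)}=x_i\dotplus\gamma$. *)

(* Defs.v *)
From HB Require Import structures.
From mathcomp Require Import all_boot all_order all_fingroup all_algebra.
From mathcomp Require Import reals complex mpoly.

Set Implicit Arguments.
Unset Strict Implicit.
Unset Printing Implicit Defensive.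

Import GRing.Theory.
Local Open Scope ring_scope.

(* The complex numbers are complex R, for R : realType.                       *)

Definition is_char (R : realType) (G : finZmodType)
    (chi : {ffun G -> complex R}) : bool :=
  [forall a, chi a != 0] && [forall a, forall b, chi (a + b) == chi a * chi b].

Record dual_group (R : realType) (G : finZmodType) := Dual {
  dual_fun :> {ffun G -> complex R};
  dual_funP : is_char dual_fun
}.

HB.instance Definition _ (R : realType) (G : finZmodType) :=
  [isSub for @dual_fun R G].
HB.instance Definition _ (R : realType) (G : finZmodType) :=
  [Choice of dual_group R G by <:].

Section DualGroup.
Context (R : realType) (G : finZmodType).
Implicit Types chi psi : dual_group R G.

Lemma dual_neq0 chi a : chi a != 0.
Proof. by case/andP: (dual_funP chi) => /forallP/(_ a). Qed.

Lemma dualD chi a b : chi (a + b) = chi a * chi b.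
Proof.
by case/andP: (dual_funP chi) => _ /forallP/(_ a)/forallP/(_ b)/eqP.
Qed.

Lemma dual_one_subproof : is_char [ffun _ : G => 1 : complex R].
Proof.
apply/andP; split; apply/forallP => a; first by rewrite ffunE oner_eq0.
by apply/forallP => b; rewrite !ffunE mulr1.
Qed.
Definition dual_one : dual_group R G := Dual dual_one_subproof.

Lemma dual_mul_subproof chi psi : is_char [ffun a => chi a * psi a].
Proof.
apply/andP; split; apply/forallP => a.
  by rewrite ffunE mulf_neq0 ?dual_neq0.
by apply/forallP => b; rewrite !ffunE !dualD mulrACA.
Qed.
Definition dual_mul chi psi : dual_group R G :=
  Dual (dual_mul_subproof chi psi).

Lemma dual_inv_subproof chi : is_char [ffun a => (chi a)^-1].
Proof.
apply/andP; split; apply/forallP => a.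
  by rewrite ffunE invr_eq0 dual_neq0.
by apply/forallP => b; rewrite !ffunE dualD invfM.
Qed.
Definition dual_inv chi : dual_group R G := Dual (dual_inv_subproof chi).

Lemma dual_mulA : associative dual_mul.
Proof. by move=> u v w; apply/val_inj/ffunP => a; rewrite !ffunE mulrA. Qed.

Lemma dual_mul1g : left_id dual_one dual_mul.
Proof. by move=> u; apply/val_inj/ffunP => a; rewrite !ffunE mul1r. Qed.

Lemma dual_mulg1 : right_id dual_one dual_mul.
Proof. by move=> u; apply/val_inj/ffunP => a; rewrite !ffunE mulr1. Qed.

Lemma dual_mulVg : left_inverse dual_one dual_inv dual_mul.
Proof.
by move=> u; apply/val_inj/ffunP => a; rewrite !ffunE mulVf ?dual_neq0.
Qed.

Lemma dual_mulgV : right_inverse dual_one dual_inv dual_mul.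
Proof.
by move=> u; apply/val_inj/ffunP => a; rewrite !ffunE mulfV ?dual_neq0.
Qed.

HB.instance Definition _ := isGroup.Build (dual_group R G)
  dual_mulA dual_mul1g dual_mulg1 dual_mulVg dual_mulgV.

End DualGroup.

(* #[_] is only available for finGroupType.                                   *)
Definition has_order (H : groupType) (h : H) (d : nat) : Prop :=
  [/\ (0 < d)%N, (h ^+ d = 1)%g
    & forall k, (0 < k < d)%N -> (h ^+ k != 1)%g].

Section Enumeration.
Context (n : nat) (G : finZmodType) (x : 'I_n -> G) (hx : bijective x).

Lemma enum_codom (g : G) : g \in codom x.
Proof. by case: hx => y _ yK; rewrite -(yK g) codom_f. Qed.

Definition enum_idx (g : G) : 'I_n := iinv (enum_codom g).

Lemma enum_idxK : cancel enum_idx x.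
Proof. by move=> g; apply: f_iinv. Qed.

Lemma enum_xK : cancel x enum_idx.
Proof. by move=> i; apply: (bij_inj hx); rewrite enum_idxK. Qed.

Lemma sigma_subproof (gamma : G) : injective (fun i => enum_idx (x i + gamma)).
Proof.
move=> i j /(can_inj enum_idxK) /(addIr gamma); exact: (bij_inj hx).
Qed.

Definition sigma (gamma : G) : 'S_n := perm (@sigma_subproof gamma).

Lemma sigmaE (gamma : G) (i : 'I_n) : x (sigma gamma i) = x i + gamma.
Proof. by rewrite permE enum_idxK. Qed.

Context (R : realType).

(* The group element g regarded as a variable.                                *)
Definition xvar (g : G) : {mpoly (complex R)[n]} := 'X_(enum_idx g).

Definition polyact (gamma : G) (f : {mpoly (complex R)[n]}) :
    {mpoly (complex R)[n]} :=
  f \mPo [tuple xvar (gamma + x i) | i < n].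

Lemma polyact_xvar (gamma g : G) : polyact gamma (xvar g) = xvar (gamma + g).
Proof.
by rewrite /polyact /xvar comp_mpolyXU -tnth_nth tnth_mktuple enum_idxK.
Qed.

Definition semi_invariant (chi : dual_group R G) (f : {mpoly (complex R)[n]}) :
    Prop :=
  forall gamma, polyact gamma f = chi gamma *: f.

(* (S^d R)^G *)
Definition invariants (d : nat) : {pred {mpoly (complex R)[n]}} :=
  [pred f | (f \is d.-homog) && [forall gamma, polyact gamma f == f]].

Definition cayley : 'M[{mpoly (complex R)[n]}]_n :=
  \matrix_(i, j) xvar (x i + x j).

Definition xmon (pi : 'S_n) : {mpoly (complex R)[n]} :=
  \prod_(i < n) xvar (x i + x (pi i)).

End Enumeration.

Definition permanent (A : comNzRingType) (n : nat) (M : 'M[A]_n) : A :=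
  \sum_(s : 'S_n) \prod_(i < n) M i (s i).

(* Main.v *)
(* Acting by g permutes the rows of the Cayley table by the translation
   sigma_g, so det(M_G) is a semi-invariant whose weight is the character
   g |-> sgn(sigma_g). The translation sigma_g has |G : <g>| cycles, all of
   length #[g], so it is odd iff #[g] is even and |G : <g>| is odd. If this
   happens for some g, a quadratic character is determined by its value at g,
   hence the sign character is the only one of order 2. Conversely, if psi is
   the only character of order 2 and psi(g) = -1, then |G : <g>| is odd, as
   otherwise <g> lies in a subgroup of index 2, which is the kernel of a
   quadratic character with value 1 at g; so sigma_g is odd.                  *)

Require Import Defs.
From HB Require Import structures.
From mathcomp Require Import all_boot all_order all_fingroup all_algebra.
From mathcomp Require Import cyclic pgroup.
From mathcomp Require Import reals complex mpoly.

Set Implicit Arguments.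
Unset Strict Implicit.
Unset Printing Implicit Defensive.

Import GRing.Theory.
Local Open Scope ring_scope.

(** * Subgroups of index 2 *)

Section IndexTwo.
Local Open Scope group_scope.
Variable gT : finGroupType.
Implicit Types G H K : {group gT}.

Lemma abelian_even_index_sub G H :
    abelian G -> H \subset G -> (2 %| #|G : H|)%N ->
  exists2 K : {group gT}, H \subset K & K \subset G /\ #|G : K| = 2%N.
Proof.
move=> abG; have [m] := ubnP #|G : H|; elim: m H => // m IHm H ltm sHG ev.
have nHG : H <| G by rewrite -sub_abelian_normal.
case: (eqVneq #|G : H| 2%N) => [idx2|idxN2]; first by exists H.
(* For a prime p dividing |G : H| / 2, an element of order p in G / H yields a
   larger subgroup, still of even index. *)
have [q def_q] := dvdnP ev; pose p := pdiv q.
have q_gt1 : (1 < q)%N.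
  by move: (indexg_gt0 G H) idxN2; rewrite def_q; case: (q) => [|[]].
have p_pr : prime p by apply: pdiv_prime.
have [r def_r] := dvdnP (pdiv_dvd q).
have cardQ : #|G / H| = (r * 2 * p)%N.
  by rewrite card_quotient ?normal_norm // def_q {1}def_r mulnAC.
have [|y Gy oy] := @Cauchy _ p (G / H)%G p_pr; first by rewrite cardQ dvdn_mull.
have sYG : <[y]> \subset G / H by rewrite cycle_subG.
have idxY : #|G : coset H @*^-1 <[y]>| = (r * 2)%N.
  rewrite -{1}(quotientGK nHG) index_cosetpre.
  apply/eqP; rewrite -(eqn_pmul2l (prime_gt0 p_pr)) -{1}oy.
  by rewrite [#[y]]orderE Lagrange //= cardQ mulnC.
have [|||K sYK [sKG idxK]] := IHm (coset H @*^-1 <[y]>)%G.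
- rewrite /= idxY -ltnS; apply: leq_trans ltm; rewrite def_q {1}def_r ltnS.
  have r_gt0 : (0 < r)%N by move: q_gt1; rewrite def_r; case: (r).
  by rewrite ltn_pmul2r // -[X in (X < _)%N]muln1 ltn_pmul2l // prime_gt1.
- by rewrite /= -(quotientGK nHG) morphpreS.
- by rewrite /= idxY dvdn_mull.
exists K => //; apply: subset_trans sYK.
by rewrite -{1}(ker_coset H) kerE morphpreS // sub1G.
Qed.

(** If neither a nor b lies in K, then G is the union of K and [b *: K]. As [a^-1] is not in K, it
    lies in [b *: K], which means that [(a * b)^-1] is in K. *)
Lemma index2_mem_mul G K a b :
    K \subset G -> #|G : K| = 2%N -> a \in G -> b \in G ->
  (a * b \in K) = ((a \in K) == (b \in K)).
Proof.
move=> sKG idxK Ga Gb.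
have [aK|aNK] := boolP (a \in K); first by rewrite groupMl //=; case: (_ \in _).
have [bK|bNK] := boolP (b \in K); first by rewrite groupMr //= (negbTE aNK).
have defG : K :|: b *: K = G.
  (* The two cosets are disjoint because b is not in K, so their union has 2 |K| = |G| elements. *)
  apply/eqP; rewrite eqEcard subUset sKG mul_subG ?sub1set //=.
  rewrite cardsU card_lcoset -(Lagrange sKG) idxK.
  rewrite (_ : K :&: b *: K = set0) ?cards0 ?subn0 ?addnn -?muln2 //.
  apply/setP=> c; rewrite !inE mem_lcoset; apply/negP=> /andP[cK].
  by rewrite groupMr // groupV (negbTE bNK).
have : a^-1 \in K :|: b *: K by rewrite defG groupV.
by rewrite inE groupV (negbTE aNK) mem_lcoset -invMg groupV /= => ->.
Qed.

End IndexTwo.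

(** * Quadratic characters *)

Section DualLemmas.
Variables (R : realType) (G : finZmodType).
Implicit Types (chi psi : dual_group R G) (a : G).

Lemma dual_mulE chi psi a : (chi * psi)%g a = chi a * psi a.
Proof. by rewrite ffunE. Qed.

Lemma dual_oneE a : (1%g : dual_group R G) a = 1.
Proof. by rewrite ffunE. Qed.

Lemma dual0 chi : chi 0 = 1.
Proof. by apply: (mulfI (dual_neq0 chi 0)); rewrite -dualD addr0 mulr1. Qed.

Lemma dualMn chi a k : chi (a *+ k) = chi a ^+ k.
Proof.
by elim: k => [|k IHk]; rewrite ?mulr0n ?dual0 // mulrS exprS dualD IHk.
Qed.

Lemma dual_eqP chi psi : (forall a, chi a = psi a) <-> chi = psi.
Proof. by split=> [e|-> //]; apply/val_inj/ffunP. Qed.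

Lemma has_order2P chi : has_order chi 2 <-> (chi * chi = 1)%g /\ chi <> 1%g.
Proof.
split=> [[_ chi2 /(_ 1%N isT)]|[chi2 chiN1]].
  by rewrite expg1 => /eqP chiN1; split=> //; rewrite -expg2.
split=> // k; case: k => [|[|k]] // _; exact/eqP.
Qed.

Lemma dual_sqr1_val chi a : (chi * chi = 1)%g -> chi a = 1 \/ chi a = -1.
Proof.
move=> /dual_eqP/(_ a); rewrite dual_mulE dual_oneE -expr2 => /eqP.
by rewrite sqrf_eq1 => /orP[] /eqP; [left | right].
Qed.

(** With m the index, [b *+ m] lies in [<[a]>], where chi is 1. So [chi b ^+ m = 1], and since
    [chi b] is 1 or -1 and m is odd, [chi b = 1]. *)
Lemma dual_sqr1_odd_index chi a :
    (chi * chi = 1)%g -> chi a = 1 -> odd #|[set: G] : <[a]>|%g ->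
  chi = 1%g.
Proof.
move=> chi2 chia oddm; apply/dual_eqP => b; rewrite dual_oneE.
have nA : (<[a]> <| [set: G])%g.
  by rewrite -sub_abelian_normal ?FinRing.zmod_abelian ?subsetT.
set m := #|_ : _|%g in oddm.
(* The class of b in the quotient by [<[a]>] is killed by m, the order of that quotient. *)
have : b *+ m \in <[a]>%g.
  rewrite -FinRing.zmodXgE; apply: coset_idr.
    by rewrite (subsetP (normal_norm nA)) ?inE.
  rewrite morphX ?(subsetP (normal_norm nA)) ?inE //.
  rewrite /m -card_quotient ?normal_norm // expg_cardG //.
  by rewrite mem_quotient ?inE.
case/cycleP => k; rewrite FinRing.zmodXgE => /(congr1 chi).
rewrite !dualMn chia expr1n; case: (dual_sqr1_val b chi2) => -> //.
by rewrite -signr_odd oddm.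
Qed.

Lemma index2_is_char (K : {group G}) :
  #|[set: G] : K|%g = 2%N ->
  is_char [ffun a => (-1) ^+ (a \notin K) : complex R].
Proof.
move=> idxK; apply/andP; split; apply/forallP => a.
  by rewrite ffunE signr_eq0.
apply/forallP => b; rewrite !ffunE -signr_addb -FinRing.zmodMgE.
by rewrite (index2_mem_mul (subsetT K) idxK) ?inE //; do 2!case: (_ \in _).
Qed.

End DualLemmas.

(** * Cycle structure of the translations *)

Section Translations.
Variables (n : nat) (G : finZmodType) (x : 'I_n -> G) (hx : bijective x).
Implicit Types g h : G.

Lemma card_enum : n = #|G|.
Proof. by rewrite -(bij_eq_card hx) card_ord. Qed.

Lemma sigmaX g k i : x ((sigma hx g ^+ k)%g i) = x i + g *+ k.
Proof.
elim: k => [|k IHk]; first by rewrite expg0 perm1 mulr0n addr0.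
by rewrite expgSr permM sigmaE IHk mulrSr addrA.
Qed.

Lemma sigmaD g h : sigma hx (g + h) = (sigma hx g * sigma hx h)%g.
Proof.
by apply/permP => i; apply: (bij_inj hx); rewrite permM !sigmaE addrA.
Qed.

(** The enumeration x carries the orbit of i onto the coset of [<[g]>] through [x i]. *)
Lemma card_porbit_sigma g i : #|porbit (sigma hx g) i| = #[g]%g.
Proof.
rewrite -(card_imset _ (bij_inj hx)) orderE -(card_lcoset <[g]>%g (x i)).
apply: eq_card => h; rewrite mem_lcoset.
apply/imsetP/cycleP => [[j /porbitP[k ->] ->]|[k hk]].
  exists k; rewrite sigmaX FinRing.zmodMgE FinRing.zmodVgE FinRing.zmodXgE.
  by rewrite addKr.
exists ((sigma hx g ^+ k)%g i); first exact: mem_porbit.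
by rewrite sigmaX -FinRing.zmodXgE -hk -FinRing.zmodMgE mulKVg.
Qed.

Lemma card_porbits_sigma g :
  #|porbits (sigma hx g)| = #|[set: G] : <[g]>|%g.
Proof.
have part : partition (porbits (sigma hx g)) [set: 'I_n].
  apply/and3P; split.
  - rewrite eqEsubset subsetT; apply/subsetP => i _.
    by apply/bigcupP; exists (porbit (sigma hx g) i);
      rewrite ?porbit_id ?imset_f.
  - apply/trivIsetP => _ _ /imsetP[i _ ->] /imsetP[j _ ->] neq.
    apply/pred0P => k /=; apply/negP => /andP[ki kj]; case/negP: neq.
    by move: ki kj; rewrite -!eq_porbit_mem => /eqP <- /eqP <-.
  - by apply/imsetP => -[i _ /setP/(_ i)]; rewrite porbit_id inE.
have unif A : A \in porbits (sigma hx g) -> #|A| = #[g]%g.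
  by case/imsetP => i _ ->; apply: card_porbit_sigma.
apply/eqP; rewrite -(eqn_pmul2r (order_gt0 g)).
rewrite -(card_uniform_partition unif part) cardsT card_ord card_enum -cardsT.
by rewrite -(Lagrange (subsetT <[g]>%g)) mulnC orderE.
Qed.

(** The parity of a permutation is that of n minus its number of cycles, here m #[g] - m = m (#[g] -
    1) with m the index of [<[g]>]. *)
Lemma odd_sigma g :
  odd_perm (sigma hx g) = ~~ odd #[g]%g && odd #|[set: G] : <[g]>|%g.
Proof.
rewrite /odd_perm card_porbits_sigma card_ord {1}card_enum -cardsT.
rewrite -(Lagrange (subsetT <[g]>%g)) oddM -orderE.
by case: (odd _); case: (odd _).
Qed.

(** * The sign character of the translations *)

Variable R : realType.

Lemma sign_sigma_is_char :
  is_char [ffun g => (-1) ^+ odd_perm (sigma hx g) : complex R].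
Proof.
apply/andP; split; apply/forallP => g; first by rewrite ffunE signr_eq0.
by apply/forallP => h; rewrite !ffunE sigmaD odd_permM signr_addb.
Qed.

Definition sign_sigma : dual_group R G := Dual sign_sigma_is_char.

Lemma sign_sigmaE g : sign_sigma g = (-1) ^+ odd_perm (sigma hx g).
Proof. by rewrite ffunE. Qed.

Lemma sign_sigma_sqr : (sign_sigma * sign_sigma = 1)%g.
Proof.
apply/dual_eqP => g.
by rewrite dual_mulE dual_oneE sign_sigmaE -expr2 sqrr_sign.
Qed.

Lemma sign_sigma_unique (chi : dual_group R G) :
  sign_sigma <> 1%g -> has_order chi 2 -> sign_sigma = chi.
Proof.
move=> epsN1 /has_order2P[chi2 chiN1].
have /existsP[g odd_g] : [exists g, odd_perm (sigma hx g)].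
  apply: contra_notT epsN1 => /existsPn even; apply/dual_eqP => g.
  by rewrite sign_sigmaE (negbTE (even g)) dual_oneE.
have /andP[_ odd_idx] : ~~ odd #[g]%g && odd #|[set: G] : <[g]>|%g.
  by rewrite -odd_sigma.
have chig : chi g = -1.
  by case: (dual_sqr1_val g chi2) => // /(dual_sqr1_odd_index chi2)/(_ odd_idx).
(* Both characters are -1 at g, so their product is 1 there; it also squares to 1, and the odd index
   makes it trivial. *)
have mul1 : (sign_sigma * chi = 1)%g.
  apply: (dual_sqr1_odd_index (a := g)) => //.
    apply/dual_eqP => h; rewrite !dual_mulE mulrACA -!dual_mulE.
    by rewrite sign_sigma_sqr chi2 mulg1.
  by rewrite dual_mulE sign_sigmaE odd_g chig mulrNN mulr1.
by apply: (mulIg chi); rewrite mul1 chi2.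
Qed.

(** As [sign_sigma] squares to 1, uniqueness leaves only its triviality to exclude. If it were
    trivial, [<[g]>] would have even index for a g with [psi g = -1], which gives a second quadratic
    character. *)
Lemma unique_order2_sign_sigma (psi : dual_group R G) :
  unique (fun chi : dual_group R G => has_order chi 2) psi -> psi = sign_sigma.
Proof.
case=> /has_order2P[psi2 psiN1] psi_uniq; apply: (psi_uniq sign_sigma).
apply/has_order2P; split=> [|eps1]; first exact: sign_sigma_sqr.
have /existsP[g psig] : [exists g, psi g != 1].
  apply: contra_notT psiN1 => /existsPn triv; apply/dual_eqP => g.
  by rewrite dual_oneE; apply/eqP; rewrite -[_ == _]negbK triv.
have psigN : psi g = -1.
  by case: (dual_sqr1_val g psi2) => // /eqP; rewrite (negbTE psig).
have ord_g : ~~ odd #[g]%g.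
  apply/negP => odd_g; have := dualMn psi g #[g]%g.
  rewrite -FinRing.zmodXgE expg_order dual0 psigN -signr_odd odd_g => /eqP.
  (* Reading -1 as [psi g] turns 1 = -1 into a contradiction with [psi g != 1]. *)
  by rewrite expr1 -psigN eq_sym (negbTE psig).
have [odd_idx|even_idx] := boolP (odd #|[set: G] : <[g]>|%g).
  have /dual_eqP/(_ g) := eps1.
  rewrite sign_sigmaE odd_sigma ord_g odd_idx dual_oneE => /eqP.
  by rewrite expr1 -psigN (negbTE psig).
have [|K sgK [_ idxK]] := abelian_even_index_sub
    (FinRing.zmod_abelian [set: G]) (subsetT <[g]>%g).
  by rewrite dvdn2.
pose chi : dual_group R G := Dual (index2_is_char R idxK).
have chiE a : chi a = (-1) ^+ (a \notin K) by rewrite ffunE.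
suff /psi_uniq psi_chi : has_order chi 2.
  by move: psig; rewrite psi_chi chiE (subsetP sgK) ?cycle_id ?eqxx.
apply/has_order2P; split=> [|/dual_eqP chi1].
  by apply/dual_eqP => a; rewrite dual_mulE dual_oneE chiE -expr2 sqrr_sign.
have KT : [set: G] \subset K.
  apply/subsetP => a _; have := chi1 a; rewrite chiE dual_oneE.
  by case: (a \in K) => // /eqP; rewrite expr1 -psigN (negbTE psig).
by have := indexg_eq1 [set: G]%G K; rewrite idxK KT.
Qed.

End Translations.

(** * The action on permanent and determinant *)

Section CayleyTable.
Variables (n : nat) (G : finZmodType) (x : 'I_n -> G) (hx : bijective x).
Variable R : realType.
Implicit Types (g : G) (s : 'S_n).

(** Replacing i by [sigma hx g i] in the right-hand product makes its factors the variables of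
    [x i + g + x (s i)]. *)
Lemma polyact_xmon g s :
  polyact hx g (xmon hx R s) = xmon hx R ((sigma hx g)^-1 * s)%g.
Proof.
rewrite /xmon [RHS](reindex_inj (@perm_inj _ (sigma hx g))) /=.
rewrite /polyact rmorph_prod; apply: eq_bigr => i _.
by rewrite sigmaE permM permK addrAC (addrC _ g); apply: polyact_xvar.
Qed.

Lemma xmonV s : xmon hx R s = xmon hx R s^-1%g.
Proof.
rewrite /xmon [RHS](reindex_inj (@perm_inj _ s)).
by apply: eq_bigr => i _; rewrite permK addrC.
Qed.

Lemma xmon_homog s : xmon hx R s \is n.-homog.
Proof.
rewrite -[X in X.-homog](card_ord n) -sum1_card /xmon.
apply: (big_ind2 (fun (p : {mpoly (complex R)[n]}) d => p \is d.-homog)).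
- exact: dhomog1.
- by move=> p d q e; apply: dhomogM.
- by move=> i _; rewrite dhomogX /= mdeg1.
Qed.

Lemma permanent_cayleyE :
  permanent (cayley hx R) = \sum_(s : 'S_n) xmon hx R s.
Proof.
by apply: eq_bigr => s _; apply: eq_bigr => i _; rewrite mxE.
Qed.

(** The signs become complex scalars, through which the linear map [polyact] passes. *)
Lemma det_cayleyE :
  \det (cayley hx R) = \sum_(s : 'S_n) (-1) ^+ s *: xmon hx R s.
Proof.
apply: eq_bigr => s _; rewrite -signr_odd scaler_sign mulr_sign oddb.
by congr (if _ then - _ else _); apply: eq_bigr => i _; rewrite mxE.
Qed.

Lemma polyact_permanent_cayley g :
  polyact hx g (permanent (cayley hx R)) = permanent (cayley hx R).
Proof.
rewrite permanent_cayleyE [RHS](reindex_inj (mulgI (sigma hx g)^-1%g)) /=.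
by rewrite /polyact raddf_sum; apply: eq_bigr => s _; apply: polyact_xmon.
Qed.

Lemma polyact_det_cayley g :
  polyact hx g (\det (cayley hx R)) =
    (-1) ^+ odd_perm (sigma hx g) *: \det (cayley hx R).
Proof.
rewrite det_cayleyE [X in _ *: X](reindex_inj (mulgI (sigma hx g)^-1%g)) /=.
rewrite /polyact raddf_sum scaler_sumr; apply: eq_bigr => s _.
rewrite /= comp_mpolyZ [_ \mPo _]polyact_xmon scalerA.
(* Reindexing multiplies each sign by that of the translation, which cancels against the weight. *)
by rewrite odd_permM odd_permV signr_addb mulrA -expr2 sqrr_sign mul1r.
Qed.

End CayleyTable.

(* (s * t)%g is "first s, then t", so pi o sigma^-1 reads (sigma^-1 * pi)%g. *)
Theorem proposition5p12 (R : realType) (n : nat) (G : finZmodType)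
    (x : 'I_n -> G) (hx : bijective x) (gamma : G) (pi : 'S_n) :
  [/\ polyact hx gamma (xmon hx R pi)
        = xmon hx R ((sigma hx gamma)^-1 * pi)%g,
      xmon hx R pi = xmon hx R (pi^-1)%g,
      permanent (cayley hx R) \in invariants hx n
    & (forall psi : dual_group R G,
         unique (fun chi : dual_group R G => has_order chi 2) psi ->
         semi_invariant hx psi (\det (cayley hx R)))
      /\ (~ (exists! psi : dual_group R G, has_order psi 2) ->
          \det (cayley hx R) \in invariants hx n)].
Proof.
split.
- exact: polyact_xmon.
- exact: xmonV.
- rewrite inE permanent_cayleyE rpred_sum => [|s _]; last exact: xmon_homog.
  by apply/forallP => g; rewrite -permanent_cayleyE polyact_permanent_cayley.
split=> [psi /(unique_order2_sign_sigma hx) -> g|not_unique].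
  by rewrite polyact_det_cayley sign_sigmaE.
(* A nontrivial sign character would be the unique one of order 2. *)
have eps1 : sign_sigma hx R = 1%g.
  apply/eqP; apply: contra_notT not_unique => /eqP epsN1.
  exists (sign_sigma hx R); split=> [|chi]; last exact: sign_sigma_unique.
  by apply/has_order2P; split=> //; apply: sign_sigma_sqr.
rewrite inE {1}det_cayleyE rpred_sum => [|s _].
  2: by rewrite rpredZ ?xmon_homog.
apply/forallP => g; rewrite polyact_det_cayley -sign_sigmaE eps1 dual_oneE.
by rewrite scale1r.
Qed.
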